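(* Let $T=\{2143,2431,3241\}$. Then $$F_T(x)=\frac{1-5x+7x^2-4x^3}{1-6x+11x^2-9x^3+2x^4}.$$
   Context: $S_n(T)$ denotes the set of permutations $\pi$ of $[n]=\{1,\dots,n\}$ (one-line notation) that avoid every pattern $\tau\in T$, i.e. no subsequence of $\pi$ is order-isomorphic to $\tau$. $F_T(x)=\sum_{n\ge 0}|S_n(T)|x^n$, a formal power series, with $|S_0(T)|=1$. *)

(* Defs.v *)
From mathcomp Require Import all_boot all_order all_algebra all_fingroup.

Set Implicit Arguments.
Unset Strict Implicit.
Unset Printing Implicit Defensive.

Import GRing.Theory.

Section PatternAvoidance.

(* One-line notation, with the values shifted from {0, .., n-1} to
   {1, .., n}. *)
Definition one_line n (s : 'S_n) : seq nat := [seq (s i).+1 | i <- enum 'I_n].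

Definition order_iso (u v : seq nat) : bool :=
  (size u == size v) &&
  [forall i : 'I_(size u), forall j : 'I_(size u),
     (nth 0 u i < nth 0 u j) == (nth 0 v i < nth 0 v j)].

(* The subsequences of a word are its masks by bit sequences of the same
   length; see containsP. *)
Definition contains n (s : 'S_n) (tau : seq nat) : bool :=
  [exists m : n.-tuple bool, order_iso (mask m (one_line s)) tau].

Definition avoiders n (T : seq (seq nat)) : {set 'S_n} :=
  [set s | all (fun tau => ~~ contains s tau) T].

Lemma containsP n (s : 'S_n) tau :
  reflect (exists2 u, subseq u (one_line s) & order_iso u tau)
          (contains s tau).
Proof.
have sz : size (one_line s) = n by rewrite size_map size_enum_ord.
apply: (iffP existsP) => [[m iso_m]|[u /subseqP[m sz_m ->] iso_m]].
  by exists (mask m (one_line s)); rewrite ?mask_subseq.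
have sz_mn : size m == n by rewrite sz_m sz.
by exists (Tuple sz_mn).
Qed.

End PatternAvoidance.

Section FormalPowerSeries.

Local Open Scope ring_scope.

Variable K : fieldType.

(* A formal power series is its coefficient sequence; equality of series is
   =1. *)
Definition fps : Type := nat -> K.

Implicit Types (f g : fps) (p : {poly K}).

Definition fps_of_poly p : fps := fun n => p`_n.

Definition fps_mul f g : fps := fun n => \sum_(i < n.+1) f i * g (n - i)%N.

(* The first n coefficients of 1 / f, by the usual recurrence
   f_0 b_m = [m = 0] - \sum_(i < m) b_i f_(m - i). *)
Fixpoint fps_inv_seq f (n : nat) : seq K :=
  if n is m.+1 then
    let b := fps_inv_seq f m in
    rcons b ((f 0%N)^-1 * ((m == 0%N)%:R - \sum_(i < m) b`_i * f (m - i)%N))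
  else [::].

(* The multiplicative inverse when f 0 != 0, and 0 otherwise. *)
Definition fps_inv f : fps := fun n => (fps_inv_seq f n.+1)`_n.

Definition fps_div f g : fps := fps_mul f (fps_inv g).

Lemma size_fps_inv_seq f n : size (fps_inv_seq f n) = n.
Proof. by elim: n => //= n IHn; rewrite size_rcons IHn. Qed.

Lemma nth_fps_inv_seq f n i : (i < n)%N -> (fps_inv_seq f n)`_i = fps_inv f i.
Proof.
elim: n => // n IHn; rewrite ltnS leq_eqVlt => /orP[/eqP-> //|lt_in].
by rewrite /= nth_rcons size_fps_inv_seq lt_in IHn.
Qed.

Lemma fps_mulVf f :
  f 0%N != 0 -> fps_mul (fps_inv f) f =1 fps_of_poly 1.
Proof.
move=> f0 n; rewrite /fps_mul big_ord_recr /= subnn /fps_of_poly coef1.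
rewrite {2}/fps_inv /= nth_rcons size_fps_inv_seq ltnn eqxx.
rewrite mulrAC mulVf // mul1r addrC -addrA [X in _ + X]addrC.
under [X in X - _]eq_bigr => i _ do rewrite -(nth_fps_inv_seq _ (ltn_ord i)).
by rewrite subrr addr0.
Qed.

End FormalPowerSeries.

Definition avoidance_gf (T : seq (seq nat)) : fps rat :=
  fun n => (#|avoiders n T|%:R)%R.

(* Main.v *)
Require Import Defs.
From mathcomp Require Import all_boot all_order all_algebra all_fingroup.
From mathcomp Require Import zify ring.

(* Split an avoider of length n+1 around its largest entry as A (n+1) B.
   If B is empty then A is any avoider.  Otherwise the patterns force every
   inversion of A to straddle all of B in value, and no inversion of B to
   straddle an entry of A.  Hence either B is an interval of values and A is a
   shuffle of two increasing words, one below and one above B; or A is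
   increasing, and B is an avoider C on an interval of values followed by a
   nonempty increasing word, an entry of A separating the two in value.
   With |C| = b (C = B in the first case),
   m = n - b entries are left, and they can be placed in 2^m ways in the first
   case and in 2^m - 1 - m ways in the second, so that
     a(n+1) = a(n) + \sum_(1 <= b <= n) (2^(n-b+1) - (n-b) - 1) a(b).
   The claim is the linear recurrence of order 4 that this implies. *)

Set Implicit Arguments.
Unset Strict Implicit.
Unset Printing Implicit Defensive.

Import GRing.Theory.

(** * One-line words and the three forbidden patterns *)

(** The disjuncts are, in order, the patterns 2143, 2431 and 3241, written as chains of strict
    inequalities so that [lia] can decide them. *)
Definition forbidden (a b c d : nat) : bool :=
  [|| (b < a) && (a < d) && (d < c),
      (d < a) && (a < c) && (c < b) |
      (d < b) && (b < a) && (a < c)].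

Definition avoid (w : seq nat) : Prop :=
  forall a b c d, subseq [:: a; b; c; d] w -> ~~ forbidden a b c d.

Definition patterns : seq (seq nat) :=
  [:: [:: 2; 1; 4; 3]; [:: 2; 4; 3; 1]; [:: 3; 2; 4; 1]].

Lemma order_isoP (u v : seq nat) :
  reflect (size u = size v /\
           forall i j, i < size u -> j < size u ->
             (nth 0 u i < nth 0 u j) = (nth 0 v i < nth 0 v j))
          (order_iso u v).
Proof.
apply: (iffP andP) => [[/eqP sz /forallP H]|[sz H]]; split=> //.
- by move=> i j lt_i lt_j; have /forallP/(_ (Ordinal lt_j))/eqP := H (Ordinal
  lt_i).
- exact/eqP.
- by apply/forallP=> i; apply/forallP=> j; apply/eqP/H.
Qed.

Lemma order_iso_patterns (a b c d : nat) :
  has (order_iso [:: a; b; c; d]) patterns = forbidden a b c d.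
Proof.
have iso4 x y z t : order_iso [:: a; b; c; d] [:: x; y; z; t] =
  [&& (a < b) == (x < y), (a < c) == (x < z), (a < d) == (x < t),
      (b < c) == (y < z), (b < d) == (y < t), (c < d) == (z < t),
      (b < a) == (y < x), (c < a) == (z < x), (d < a) == (t < x),
      (c < b) == (z < y), (d < b) == (t < y) & (d < c) == (t < z)].
  apply/order_isoP/idP => [[_ H]|H].
    by rewrite (H 0 1) ?(H 0 2) ?(H 0 3) ?(H 1 2) ?(H 1 3) ?(H 2 3) ?(H 1 0)
      ?(H 2 0) ?(H 3 0) ?(H 2 1) ?(H 3 1) ?(H 3 2) ?eqxx.
  split=> // -[|[|[|[|//]]]] [|[|[|[|//]]]] _ _ /=; rewrite ?ltnn //; lia.
rewrite /patterns /= !iso4 /forbidden /=; lia.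
Qed.

Lemma size_one_line n (s : 'S_n) : size (one_line s) = n.
Proof. by rewrite size_map size_enum_ord. Qed.

Lemma one_line_inj n : injective (@one_line n).
Proof.
move=> s t /eq_in_map H; apply/permP=> i; apply/val_inj/succn_inj.
by apply: H; rewrite mem_enum.
Qed.

Lemma perm_one_line n (s : 'S_n) : perm_eq (one_line s) (iota 1 n).
Proof.
have -> : one_line s = [seq (val i).+1 | i <- map s (enum 'I_n)] by rewrite
  -map_comp.
have -> : iota 1 n = [seq (val i).+1 | i <- enum 'I_n].
  by rewrite -[1]addn0 iotaDl -val_enum_ord -map_comp; apply: eq_map => i /=.
apply/perm_map/uniq_perm; rewrite ?(map_inj_uniq perm_inj) ?enum_uniq //.
move=> i; rewrite mem_enum inE; apply/mapP; exists (s^-1 i)%g;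
  rewrite ?mem_enum //.
by rewrite permKV.
Qed.

Lemma one_line_surj n (w : seq nat) :
  perm_eq w (iota 1 n) -> exists s : 'S_n, w = one_line s.
Proof.
move=> pw; have sz : size w = n by rewrite (perm_size pw) size_iota.
have uw : uniq w by rewrite (perm_uniq pw) iota_uniq.
have in_w (i : 'I_n) : 0 < nth 0 w i < n.+1.
  have : nth 0 w i \in iota 1 n by rewrite -(perm_mem pw) mem_nth ?sz.
  by rewrite mem_iota.
have lt_w (i : 'I_n) : (nth 0 w i).-1 < n by have := in_w i; lia.
pose f i := Ordinal (lt_w i).
have inj_f : injective f.
  move=> i j [] eq_ij; apply: ord_inj; apply/eqP.
  have eq_w : nth 0 w i = nth 0 w j by have := in_w i; have := in_w j; lia.
  by rewrite -(nth_uniq 0 _ _ uw) ?sz // eq_w.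
exists (perm inj_f); apply: (@eq_from_nth _ 0);
  rewrite ?size_one_line // => i lt_i.
rewrite sz in lt_i.
rewrite (nth_map (Ordinal lt_i)) ?size_enum_ord // permE /=.
by rewrite nth_enum_ord //= prednK //; case/andP: (in_w (Ordinal lt_i)).
Qed.

Definition words n : seq (seq nat) :=
  [seq one_line s | s <- enum (avoiders n patterns)].

Lemma size_words n : size (words n) = #|avoiders n patterns|.
Proof. by rewrite size_map cardE. Qed.

Lemma uniq_words n : uniq (words n).
Proof. by rewrite (map_inj_uniq (@one_line_inj n)) enum_uniq. Qed.

Lemma avoidP n (s : 'S_n) : reflect (avoid (one_line s)) (s \in avoiders n
  patterns).
Proof.
rewrite inE; apply: (iffP allP) => [H a b c d sub|H tau tau_p].
  rewrite -order_iso_patterns; apply/hasPn => tau tau_p.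
  by apply: contra (H _ tau_p) => iso; apply/containsP; exists [:: a; b; c; d].
apply/containsP=> -[u sub iso].
have := proj1 (elimT (order_isoP _ _) iso).
have -> : size tau = 4 by move: tau_p; rewrite !inE => /or3P[] /eqP->.
case: u sub iso => [|a [|b [|c [|d [|//]]]]] //= sub iso _.
have /negP := H _ _ _ _ sub; apply; rewrite -order_iso_patterns; apply/hasP.
by exists tau.
Qed.

Lemma mem_words n w : w \in words n <-> perm_eq w (iota 1 n) /\ avoid w.
Proof.
split=> [/mapP[s]|[/one_line_surj[s ->] av]].
  by rewrite mem_enum => /avoidP av ->; split; first exact: perm_one_line.
by apply: map_f; rewrite mem_enum; apply/avoidP.
Qed.

Lemma avoid_subseq v w : subseq v w -> avoid w -> avoid v.
Proof. by move=> sub av a b c d /subseq_trans/(_ sub)/av. Qed.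

Lemma avoid_addl l w : avoid (map (addn l) w) <-> avoid w.
Proof.
split=> av a b c d sub.
  have := av (l + a) (l + b) (l + c) (l + d) (map_subseq (addn l) sub).
  by rewrite /forbidden; lia.
have : {in [:: a; b; c; d], forall x, l <= x}.
  by move=> x /(mem_subseq sub)/mapP[y _ ->]; rewrite leq_addr.
move=> H; have := H a; have := H b; have := H c; have := H d.
rewrite !inE !eqxx !orbT => /(_ isT) Hd /(_ isT) Hc /(_ isT) Hb /(_ isT) Ha.
have := av (a - l) (b - l) (c - l) (d - l).
have /= := map_subseq (subn^~ l) sub.
rewrite -map_comp map_id_in => [|x _]; last by rewrite /= addKn.
by move=> s /(_ s); rewrite /forbidden; lia.
Qed.

(** * Relative position of two entries of a word *)

Lemma subseq4 (T : eqType) (a b c d : T) w : subseq [:: a; b; c; d] w ->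
  [/\ subseq [:: a; b] w, subseq [:: a; c] w & subseq [:: a; d] w] /\
  [/\ subseq [:: b; c] w, subseq [:: b; d] w & subseq [:: c; d] w].
Proof.
move=> sub; do !split.
- exact: subseq_trans (mask_subseq [:: true; true; false; false] _) sub.
- exact: subseq_trans (mask_subseq [:: true; false; true; false] _) sub.
- exact: subseq_trans (mask_subseq [:: true; false; false; true] _) sub.
- exact: subseq_trans (mask_subseq [:: false; true; true; false] _) sub.
- exact: subseq_trans (mask_subseq [:: false; true; false; true] _) sub.
- exact: subseq_trans (mask_subseq [:: false; false; true; true] _) sub.
Qed.

Lemma subseq2_catl (T : eqType) (x y : T) s1 s2 :
  uniq (s1 ++ s2) -> subseq [:: x; y] (s1 ++ s2) -> y \in s1 -> x \in s1.
Proof.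
elim: s1 => //= z s1 IH /andP[z_ni u]; rewrite !inE.
case: eqVneq => //= neq_xz sub /predU1P[eq_yz|]; last exact: IH.
by move/mem_subseq/(_ y): sub;
  rewrite !inE eqxx orbT eq_yz (negPf z_ni) => /(_ isT).
Qed.

Lemma subseq2_neq (T : eqType) (x y : T) s :
  uniq s -> subseq [:: x; y] s -> x != y.
Proof. by move=> u /subseq_uniq/(_ u); rewrite /= inE andbT. Qed.

Lemma subseq2_total (T : eqType) (x y : T) s :
  x \in s -> y \in s -> x != y -> subseq [:: x; y] s || subseq [:: y; x] s.
Proof.
elim: s => //= z s IH; rewrite !inE.
case: (eqVneq x z) => [->|_] /=; case: (eqVneq y z) => [->|_] //=.
- by move=> _ y_s _; rewrite !sub1seq y_s.
- by move=> x_s _ _; rewrite !sub1seq x_s orbT.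
Qed.

Lemma subseq2_sorted (x y : nat) (P : pred nat) s :
  sorted ltn (filter P s) -> subseq [:: x; y] s -> P x -> P y -> x < y.
Proof.
move=> srt sub Px Py.
have : subseq [:: x; y] (filter P s) by rewrite subseq_filter sub /= Px Py.
by move/(subseq_sorted ltn_trans)/(_ srt); rewrite /= andbT.
Qed.

Lemma sorted_subseq2 s :
  (forall x y, subseq [:: x; y] s -> x < y) -> sorted ltn s.
Proof.
rewrite (sorted_pairwise ltn_trans); elim: s => //= x s IH H.
rewrite IH ?andbT => [|y z sub]; last first.
  by apply: H; case: eqP => // _;
    apply: subseq_trans (subseq_cons [:: z] y) sub.
by apply/allP => y y_s; apply: H; rewrite eqxx sub1seq.
Qed.

(** In a duplicate-free word a subsequence is determined by its letters: [s] is the filter of [w] by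
    membership in [s]. *)
Lemma subseq_uniq_sub (T : eqType) (u s w : seq T) :
  uniq w -> subseq s w -> subseq u w -> {subset u <= s} -> subseq u s.
Proof.
move=> uw /(subseq_uniqP uw) sE sub us; rewrite sE subseq_filter sub andbT.
by apply/allP.
Qed.

(** * Blocks of consecutive values, interleavings and masks *)

(** Sorting each block makes the concatenation sorted, hence equal to the whole interval, which is
    then cut by length. *)
Lemma perm_iota_cat X Y s n :
    perm_eq (X ++ Y) (iota s n) -> {in X & Y, forall x y, x < y} ->
  perm_eq X (iota s (size X)) /\ perm_eq Y (iota (s + size X) (size Y)).
Proof.
move=> pXY ltXY; have sz := perm_size pXY; rewrite size_cat size_iota in sz.
have /eqP : sort leq X ++ sort leq Y = iota s n.
  apply: (sorted_eq leq_trans anti_leq); last 1 first.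
  - by apply: perm_trans pXY; apply: perm_cat; rewrite perm_sort.
  - rewrite (sorted_pairwise leq_trans) pairwise_cat -!(sorted_pairwise
    leq_trans).
    rewrite !(sort_sorted leq_total) !andbT; apply/allrelP => x y.
    by rewrite !mem_sort => xX yY; apply/ltnW/ltXY.
  - exact: iota_sorted.
rewrite -sz iotaD eqseq_cat ?size_sort ?size_iota // => /andP[/eqP <- /eqP <-].
by rewrite !(perm_sym _ (sort _ _)) !perm_sort.
Qed.

Lemma sorted_perm_iota X s n :
  sorted ltn X -> perm_eq X (iota s n) -> X = iota s n.
Proof.
by move=> srt p; apply: (irr_sorted_eq ltn_trans ltnn _ (iota_ltn_sorted s n))
  => //; apply: perm_mem.
Qed.

(* [shuffle t x y] interleaves the runs x, x+1, ... and y, y+1, ... as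
   prescribed by t, true standing for an element of the second one. *)
Fixpoint shuffle (t : bitseq) (x y : nat) : seq nat :=
  if t is b :: t' then
    if b then y :: shuffle t' x y.+1 else x :: shuffle t' x.+1 y
  else [::].

Lemma perm_shuffle t x y :
  perm_eq (shuffle t x y) (iota x (count negb t) ++ iota y (count id t)).
Proof.
elim: t x y => //= -[] t IH x y /=; rewrite ?add0n ?add1n /= ?perm_cons //.
by rewrite perm_sym perm_catC /= perm_cons perm_catC perm_sym.
Qed.

(** With [p := ltn h] this encodes a prefix A whose entries below and above B each increase. *)
Lemma shuffleE (p : pred nat) A x y :
    filter (predC p) A = iota x (count (predC p) A) ->
    filter p A = iota y (count p A) ->
  A = shuffle (map p A) x y.
Proof.
elim: A x y => //= a A IH x y; case: (p a) => /=; rewrite ?add0n ?add1n /=.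
  by move=> H0 [-> H1]; congr cons; apply: IH.
by move=> [-> H0] H1; congr cons; apply: IH.
Qed.

(** The first run stays at most [h] and the second lies above it, so comparison with [h] reads [t]
    back. This makes the encoding by [t] injective. *)
Lemma map_ltn_shuffle h t x y :
  x + count negb t <= h.+1 -> h < y -> map (ltn h) (shuffle t x y) = t.
Proof.
elim: t x y => //= -[] t IH x y /=; rewrite ?add0n ?add1n => lex lty.
  by rewrite lty IH // ltnW.
by rewrite IH ?addSnnS // (_ : h < x = false) //; lia.
Qed.

Lemma filter_shuffle h t x y : x + count negb t <= h.+1 -> h < y ->
  filter (leq^~ h) (shuffle t x y) = iota x (count negb t) /\
  filter (ltn h) (shuffle t x y) = iota y (count id t).
Proof.
elim: t x y => //= -[] t IH x y /=; rewrite ?add0n ?add1n => lex lty.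
  have [-> ->] := IH x y.+1 lex (ltnW lty); rewrite lty.
  by rewrite leqNgt lty; split.
have [||-> ->] := IH x.+1 y; rewrite ?addSnnS //.
have lexh : x <= h by lia.
by rewrite lexh ltnNge lexh.
Qed.

Lemma perm_mask (T : eqType) (t : bitseq) (s : seq T) : size t = size s ->
  perm_eq (mask t s ++ mask (map negb t) s) s.
Proof.
elim: t s => [[|//] //|b t IH [//|x s] [sz]].
case: b => /=; first by rewrite perm_cons IH.
by rewrite perm_catC /= perm_cons perm_catC IH.
Qed.

Lemma mask_inj (T : eqType) (t t' : bitseq) (s : seq T) :
    uniq s -> size t = size s -> size t' = size s ->
  mask t s = mask t' s -> t = t'.
Proof.
elim: s t t' => [|x s IH] [|b t] [|b' t'] //=; case/andP=> x_ni u [sz] [sz'].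
case: b; case: b' => /= eqx.
- by case: eqx => /IH ->.
- by move: x_ni; rewrite (mem_mask (m := t')) // -eqx mem_head.
- by move: x_ni; rewrite (mem_mask (m := t)) // eqx mem_head.
- by rewrite (IH _ _ u sz sz' eqx).
Qed.

(** The first occurrence of [x] gives the length of the prefix. It is applied with the largest entry
    as [x]. *)
Lemma cat_cons_inj (T : eqType) (x : T) A B A' B' : x \notin A -> x \notin A' ->
  A ++ x :: B = A' ++ x :: B' -> A = A' /\ B = B'.
Proof.
move=> xA xA' eqw; have szA : size A = size A'.
  by rewrite -(index_pivot B xA) eqw index_pivot.
by move/eqP: eqw; rewrite eqseq_cat // => /andP[/eqP-> /eqP[->]].
Qed.

(** * A criterion for avoidance *)

(** It covers both shapes with B nonempty: empty [R] for the first, increasing [A] for the second.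
    Four entries not all in [C] are distributed over the blocks [A], [n], [C], [R] in finitely many
    ways, and in each the order constraints exclude the three patterns. *)
Lemma avoid_inflation (A C R : seq nat) (n lo hi : nat) :
    lo <= hi -> uniq (A ++ n :: C ++ R) ->
    {in A ++ C ++ R, forall x, x < n} ->
    {in A, forall x, (x <= lo) || (hi < x)} ->
    sorted ltn (filter (leq^~ lo) A) -> sorted ltn (filter (ltn hi) A) ->
    {in C, forall x, lo < x <= hi} -> {in R, forall x, hi < x} ->
    sorted ltn R -> R = [::] \/ sorted ltn A ->
  avoid C -> avoid (A ++ n :: C ++ R).
Proof.
move=> lo_hi uw lt_n A_out A_lo A_hi C_in R_hi R_srt RA av a b c d sub.
set w := A ++ _ in uw sub.
have wE : w = (rcons A n ++ C) ++ R by rewrite -catA cat_rcons.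
have subA : subseq A w by apply: prefix_subseq.
have subR : subseq R w by rewrite wE suffix_subseq.
have subC : subseq C w.
  by rewrite wE; apply: subseq_trans (prefix_subseq _ _); apply: suffix_subseq.
have sub2 s x y : subseq s w -> subseq [:: x; y] w -> x \in s -> y \in s ->
    subseq [:: x; y] s.
  move=> ss xy xs ys; apply: subseq_uniq_sub xy _ => // z.
  by rewrite !inE => /orP[] /eqP->.
have srtT s : sorted ltn s ->
  sorted ltn (filter predT s) by rewrite filter_predT.
(* The alternative [RA] is used as an implication: as soon as [R] has an entry, [A] increases. The
   function [k] numbers the blocks from left to right. *)
pose r := R != [::].
pose k x := if x \in A then 0 else if x == n then 1 else if x \in C then 2 else
  3.
have place x : x \in w ->
  [\/ [/\ k x = 0, x \in A, x < n & (x <= lo) || (hi < x)],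
      [/\ k x = 1 & x = n],
      [/\ k x = 2, x \in C, x < n & lo < x <= hi] |
      [/\ k x = 3, x \in R, r & (x < n) && (hi < x)]].
  have n_ni : n \notin A ++ C ++ R by apply/negP => /lt_n; rewrite ltnn.
  have lt_x : x \in A ++ C ++ R -> x < n := lt_n x.
  rewrite /k /w mem_cat inE mem_cat; case: eqVneq n_ni lt_x => [-> | _ _].
    by rewrite mem_cat; case: (n \in A) => //; constructor 2.
  rewrite !mem_cat; case xA: (x \in A) => /=.
    by move=> /(_ isT) lt_x _; constructor 1; split=> //; apply: A_out.
  case xC: (x \in C) => /=.
    by move=> /(_ isT) lt_x _; constructor 3; split=> //; apply: C_in.
  move=> H xR; constructor 4; split=> //; last by rewrite H ?R_hi.
  by apply: contraTneq xR => ->.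
have kA x : k x = 0 -> x \in A by rewrite /k; do 3?[case: ifP => // _].
have kC x : k x = 2 -> x \in C by rewrite /k; do 3?[case: ifP => // _].
have kR x : x \in w -> k x = 3 -> x \in R.
  by case/place; case=> ->.
(* As [k] is at most 3, a sum 0 means that both entries are in [A], and a sum 6 that both are in
   [R]. *)
have before x y : subseq [:: x; y] w -> 
  [/\ x != y, k x <= k y &
      if k x + k y == 0 then
        [|| (x <= lo) && (y <= lo), (hi < x) && (hi < y) | r] -> x < y
      else k x + k y = 6 -> x < y].
  move=> xy.
  have [xw yw] : x \in w /\ y \in w by rewrite -!sub1seq; split; 
     [apply: subseq_trans (mask_subseq [:: true; false] _) xy
     |apply: subseq_trans (mask_subseq [:: false; true] _) xy].
  have uw1 : uniq (rcons A n ++ C ++ R) by rewrite catA -wE.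
  have uw2 : uniq ((rcons A n ++ C) ++ R) by rewrite -wE.
  have xyE : w = rcons A n ++ C ++ R by rewrite wE catA.
  have yA := subseq2_catl uw xy.
  have yN : y \in rcons A n -> x \in rcons A n.
    by apply: (subseq2_catl uw1); rewrite -xyE.
  have yC : y \in rcons A n ++ C -> x \in rcons A n ++ C.
    by apply: (subseq2_catl uw2); rewrite -wE.
  have neq := subseq2_neq uw xy.
  split=> //.
    move: yA yN yC; rewrite !(mem_cat, mem_rcons, inE) /k.
    case: (x \in A); case: (y \in A); case: (x == n); case: (y == n);
    case: (x \in C); case: (y \in C) => //= H1 H2 H3;
    by [have := H1 isT | have := H2 isT | have := H3 isT].
  case: ifPn => [|_ k6].
    rewrite addn_eq0 => /andP[/eqP/kA xA /eqP/kA yA'].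
    have xyA := sub2 _ _ _ subA xy xA yA'.
    case/or3P => [/andP[]|/andP[]|R_n0].
    + exact: subseq2_sorted A_lo xyA.
    + exact: subseq2_sorted A_hi xyA.
    + case: RA => [R0|/srtT A_srt]; first by rewrite /r R0 in R_n0.
      by apply: subseq2_sorted A_srt xyA _ _.
  have k3 z : k z <= 3 by rewrite /k; do 3?[case: ifP => // _].
  have [kx ky] : k x = 3 /\ k y = 3.
    by move: (k x) (k y) (k3 x) (k3 y) k6; clear; lia.
  have xR := kR _ xw kx; have yR := kR _ yw ky.
  by apply: subseq2_sorted (srtT _ R_srt) (sub2 _ _ _ subR xy xR yR) _ _.
have [[ab ac ad] [bc bd cd]] := subseq4 sub.
case/boolP: [&& k a == 2, k b == 2, k c == 2 & k d == 2] => [|not2].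
  case/and4P=> /eqP/kC aC /eqP/kC bC /eqP/kC cC /eqP/kC dC.
  apply: av; apply: subseq_uniq_sub sub _ => //.
  by apply/allP; rewrite /= aC bC cC dC.
have inw x : x \in [:: a; b; c; d] -> x \in w by apply: mem_subseq.
have := place a; have := place b; have := place c; have := place d.
rewrite !inw ?inE ?eqxx ?orbT //.
move=> /(_ isT) pd /(_ isT) pc /(_ isT) pb /(_ isT) pa.
(* What remains is arithmetic: block numbers that decrease from left to right are discarded at once,
   and [lia] refutes the patterns for each other distribution. *)
clearbody r k; rewrite /forbidden;
  clear -lo_hi before pa pb pc pd ab ac ad bc bd cd not2.
case: pa => [[ka ? ? ?]|[ka ?]|[ka ? ? ?]|[ka ? ? ?]];
case: pb => [[kb ? ? ?]|[kb ?]|[kb ? ? ?]|[kb ? ? ?]];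
  case: (before _ _ ab); rewrite ka kb => ? leab;
  try discriminate leab; rewrite /= ?eqxx => ?;
case: pc => [[kc ? ? ?]|[kc ?]|[kc ? ? ?]|[kc ? ? ?]];
  case: (before _ _ bc); rewrite kb kc => ? lebc;
  try discriminate lebc; rewrite /= ?eqxx => ?;
  case: (before _ _ ac); rewrite ka kc => ? leac;
  try discriminate leac; rewrite /= ?eqxx => ?;
case: pd => [[kd ? ? ?]|[kd ?]|[kd ? ? ?]|[kd ? ? ?]];
  case: (before _ _ cd); rewrite kc kd => ? lecd;
  try discriminate lecd; rewrite /= ?eqxx => ?;
  case: (before _ _ bd); rewrite kb kd => ? lebd;
  try discriminate lebd; rewrite /= ?eqxx => ?;
  case: (before _ _ ad); rewrite ka kd => ? lead;
  try discriminate lead; rewrite /= ?eqxx => ?;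
rewrite ka kb kc kd in not2; try discriminate not2;
clear w k before ab ac ad bc bd cd not2 ka kb kc kd; lia.
Qed.

(** * Decomposition of an avoider around its largest entry *)

Lemma size_mem_words n w : w \in words n -> size w = n.
Proof. by case/mem_words => /perm_size-> _; rewrite size_iota. Qed.

Lemma bound_words n w x : w \in words n -> x \in w -> 0 < x <= n.
Proof. by case/mem_words => /perm_mem-> _; rewrite mem_iota add1n. Qed.

Lemma words_interval l B : perm_eq B (iota l.+1 (size B)) -> avoid B ->
  exists2 u, u \in words (size B) & B = map (addn l) u.
Proof.
move=> pB avB; pose u := map (subn^~ l) B.
have Bu : B = map (addn l) u.
  rewrite -map_comp map_id_in // => x; rewrite (perm_mem pB) mem_iota /=.
  by move=> /andP[ltlx _]; rewrite subnKC // ltnW.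
exists u => //; apply/mem_words; split; last by apply/(avoid_addl l);
  rewrite -Bu.
apply: (perm_map_inj (@addnI l)); rewrite -Bu.
by rewrite -iotaDl addn1.
Qed.

Lemma subseq2_trans (T : eqType) (x y z : T) s : uniq s ->
  subseq [:: x; y] s -> subseq [:: y; z] s -> subseq [:: x; z] s.
Proof.
elim: s => //= v s IH /andP[v_ni u].
have v_ni2 a b : subseq [:: a; b] s -> b != v.
  by move/mem_subseq/(_ b); rewrite !inE eqxx orbT => /(_ isT);
    apply: contraTneq => ->.
case: (eqVneq x v) => _.
  rewrite !sub1seq => y_s; case: (eqVneq y v) => [eq_yv|_].
    by rewrite -eq_yv y_s in v_ni.
  by move/mem_subseq; apply; rewrite !inE eqxx orbT.
by move=> xy; rewrite (negPf (v_ni2 _ _ xy)); apply: IH.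
Qed.

(** The hypothesis says that [p] can only switch from true to false along [s]. *)
Lemma filter_split (T : eqType) (p : pred T) s :
    (forall x y, subseq [:: x; y] s -> p y -> p x) ->
  s = filter p s ++ filter (predC p) s.
Proof.
elim: s => //= x s IH H; case: ifP => px.
  rewrite /= -IH // => y z sub; apply: H.
  by case: eqP => // _; apply: subseq_trans (subseq_cons [:: z] y) sub.
have np : all (predC p) s.
  apply/allP => y y_s /=; apply: contraFN px => py; apply: H py.
  by rewrite eqxx sub1seq.
rewrite /= (all_filterP np) (_ : filter p s = [::]) //.
by apply/eqP; rewrite -(negbK (_ == _)) -has_filter -all_predC.
Qed.

(* The two shapes of A (n+1) B with B nonempty; u is the pattern of B, resp. of
   its initial part C. *)
Definition shuffled_word (t : bitseq) (u : seq nat) : seq nat :=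
  let l := count negb t in
  shuffle t 1 (l + size u).+1 ++ (size t + size u).+1 :: map (addn l) u.

Definition sorted_word (i : nat) (t : bitseq) (u : seq nat) : seq nat :=
  let k := (i + size u).+1 in
  let s := iota k.+1 (size t) in
  (iota 1 i ++ k :: mask t s) ++
  (k + size t).+1 :: map (addn i) u ++ mask (map negb t) s.

(** For nonempty B with first entry [h], the last two shapes are told apart by whether some entry of
    A lies in value between [h] and a larger entry of B. *)
Lemma words_decomp n w : perm_eq w (iota 1 n.+1) -> avoid w ->
  [\/ exists2 u, u \in words n & w = rcons u n.+1,
      exists t u, [/\ size t + size u = n, 0 < size u, u \in words (size u)
                    & w = shuffled_word t u] |
      exists i t u, [/\ (i + size u).+1 + size t = n,
         (0 < size u) && ~~ all id t, u \in words (size u) & w =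
           sorted_word i t u]].
Proof.
move=> pw avw; have uw : uniq w by rewrite (perm_uniq pw) iota_uniq.
have nw : n.+1 \in w by rewrite (perm_mem pw) mem_iota add1n /=.
have lt_w x : x \in w -> 0 < x <= n.+1 by rewrite (perm_mem pw) mem_iota.
case/splitPr: nw pw avw uw lt_w => A B pw avw uw lt_w.
move: (uw); rewrite cat_uniq /= negb_or =>
  /and3P[uA /andP[nA nAB] /andP[nB uB]].
have disj x y : x \in A -> y \in B -> x != y.
  by move=> xA yB; apply: contraNneq nAB => eqxy; apply/hasP; exists y => //;
    rewrite -eqxy.
have ltA x : x \in A -> x < n.+1.
  move=> xA; have := lt_w x; rewrite mem_cat xA => /(_ isT).
  have : x != n.+1 by apply: contraNneq nA => <-.
  by lia.
have ltB x : x \in B -> x < n.+1.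
  move=> xB; have := lt_w x; rewrite mem_cat inE xB !orbT => /(_ isT).
  have : x != n.+1 by apply: contraNneq nB => <-.
  by lia.
have szw : size A + size B = n.
  by have := perm_size pw; rewrite size_cat /= size_iota; lia.
have avA : avoid A by apply: avoid_subseq avw; apply: prefix_subseq.
have avB : avoid B.
  by apply: avoid_subseq avw; rewrite -cat_rcons; apply: suffix_subseq.
case: B => [|h B] in pw avw uw lt_w nAB nB uB disj ltB szw avB *.
  constructor 1; exists A; last by rewrite cats1.
  apply/mem_words; split=> //.
  have [|pA _] := perm_iota_cat pw; first by move=> x y /ltA ltx;
    rewrite inE => /eqP->.
  by rewrite -szw addn0.
(* In [x], [y], [n.+1], [b], a value [b] below [y] gives 3241 and one above [x] gives 2143. *)
have F1 x y b : subseq [:: x; y] A -> y < x -> b \in h :: B -> y < b < x.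
  move=> xy lt_yx bB; have [xA yA] : x \in A /\ y \in A.
    by split; apply: (mem_subseq xy); rewrite !inE eqxx ?orbT.
  have := disj _ _ xA bB; have := disj _ _ yA bB; have := ltA _ xA;
    have := ltB _ bB.
  have bB1 : subseq [:: b] (h :: B) by rewrite sub1seq.
  have sub := cat_subseq (subseq_refl [:: n.+1]) bB1.
  by have := avw _ _ _ _ (cat_subseq xy sub); rewrite /forbidden; clear -lt_yx;
    lia.
(* Otherwise [a], [n.+1], [c], [d] form 2431. *)
have F2 a c d : a \in A -> subseq [:: c; d] (h :: B) -> d < a -> a < c -> False.
  move=> aA cd lt_da lt_ac; have cB : c \in h :: B.
    by apply: (mem_subseq cd); rewrite mem_head.
  have sub := cat_subseq (subseq_refl [:: n.+1]) cd.
  have := ltB _ cB; have aA1 : subseq [:: a] A by rewrite sub1seq.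
  by have := avw _ _ _ _ (cat_subseq aA1 sub); rewrite /forbidden;
    clear -lt_da lt_ac; lia.
have F2h a d : a \in A -> d \in h :: B -> d < a -> a < h -> False.
  move=> aA; rewrite inE => /predU1P[->|dB lt_da lt_ah].
    by move=> lt1 lt2; have := ltn_trans lt1 lt2; rewrite ltnn.
  by apply: F2 aA _ lt_da lt_ah; rewrite /= eqxx sub1seq.
case: (boolP (has (fun a => has (fun d => h < a < d) (h :: B)) A)) => [|noA].
  case/hasP=> a aA /hasP[d dB /andP[lt_ha lt_ad]].
  have hB : h \in h :: B by apply: mem_head.
  (* By [F1] an inversion [x], [y] of A straddles both [h] and [d]. If [a] comes before [y], the
     inversion [a], [y] fails to straddle [d]; if after, the inversion [x], [a] fails to straddle
     [h]. *)
  have srtA : sorted ltn A.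
    apply: sorted_subseq2 => x y xy; have := subseq2_neq uA xy.
    case: ltngtP => // lt_yx _.
    have /andP[lt_yh lt_hx] := F1 x y h xy lt_yx hB.
    have /andP[lt_yd lt_dx] := F1 x y d xy lt_yx dB.
    have yA : y \in A by apply: (mem_subseq xy); rewrite !inE eqxx orbT.
    have neq_ay : a != y by apply: contraTneq lt_ha => ->; rewrite -leqNgt ltnW.
    case/orP: (subseq2_total aA yA neq_ay) => [ay|ya].
      have := F1 a y d ay (ltn_trans lt_yh lt_ha) dB.
      by rewrite [d < a]ltnNge (ltnW lt_ad) andbF.
    have xa := subseq2_trans uA xy ya.
    have := F1 x a h xa (ltn_trans lt_ad lt_dx) hB.
    by rewrite [a < h]ltnNge ltnW.
  have ltA2 x y : subseq [:: x; y] A -> x < y.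
    by move/(subseq_sorted ltn_trans)/(_ srtA); rewrite /= andbT.
  set A0 := filter (gtn h) A.
  have EA : A = A0 ++ filter (predC (gtn h)) A.
    by apply: filter_split => x y /ltA2 lt_xy /(ltn_trans lt_xy).
  have a_hi : a \in filter (predC (gtn h)) A by rewrite mem_filter /= -leqNgt
    ltnW.
  (* As A increases, its entries above [h] form a suffix. The head [a0] of this suffix, the least of
     them, is the value that separates C from the rest of B. *)
  case EA1 : (filter _ A) a_hi EA => [//|a0 A1] a_hi EA.
  have a0P : a0 \in a0 :: A1 by apply: mem_head.
  have [a0A lt_ha0] : a0 \in A /\ h < a0.
    move: a0P; rewrite -EA1 mem_filter /= -leqNgt => /andP[le_ha0 a0A].
    by rewrite ltn_neqAle le_ha0 eq_sym disj.
  have lt_a0A1 x : x \in A1 -> a0 < x.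
    move=> xA1; apply: ltA2; rewrite EA;
      apply: subseq_trans (suffix_subseq _ _).
    by rewrite /= eqxx sub1seq.
  have le_a0a : a0 <= a by move: a_hi;
    rewrite inE => /predU1P[->//|/lt_a0A1/ltnW].
  set C := filter (gtn a0) (h :: B); set R := filter (predC (gtn a0)) (h :: B).
  (* By [F2], no entry of B above [a0] precedes one below it. *)
  have EB : h :: B = C ++ R.
    apply: filter_split => x y xy /= lt_ya0; rewrite ltnNge;
      apply/negP => le_a0x.
    apply: (F2 _ _ _ a0A xy lt_ya0); rewrite ltn_neqAle le_a0x andbT disj //.
    by apply: (mem_subseq xy); apply: mem_head.
  have CB x : x \in C -> x \in h :: B by rewrite EB mem_cat => ->.
  have RB x : x \in R -> x \in h :: B by rewrite EB mem_cat orbC => ->.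
  have hC : h \in C by rewrite mem_filter /= lt_ha0.
  have dR : d \in R by rewrite mem_filter /= dB -leqNgt (leq_trans le_a0a (ltnW
    lt_ad)).
  have C_lt x : x \in C -> x < a0 by rewrite mem_filter => /andP[].
  have R_gt x : x \in R -> a0 < x.
    move=> xR; rewrite ltn_neqAle (disj _ _ a0A (RB x xR)).
    by move: xR; rewrite mem_filter /= -leqNgt => /andP[].
  have A0_lt x y : x \in A0 -> y \in C -> x < y.
    rewrite mem_filter /= => /andP[lt_xh xA] /CB yB.
    have := disj _ _ xA yB; have := F2h x y xA yB; clear -lt_xh; lia.
  have srtA1 : sorted ltn (a0 :: A1).
    by apply: (subseq_sorted ltn_trans) srtA; rewrite EA suffix_subseq.
  have srtA0 : sorted ltn A0.
    by apply: (subseq_sorted ltn_trans) srtA; apply: filter_subseq.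
  (* An inversion of [R], preceded by [a0] and [h], would form 2143. *)
  have srtR : sorted ltn R.
    apply: sorted_subseq2 => x y xy.
    have uR : uniq R by apply: filter_uniq.
    have := subseq2_neq uR xy; case: ltngtP => // lt_yx _.
    have yR : y \in R by apply: (mem_subseq xy); rewrite !inE eqxx orbT.
    have hC1 : subseq [:: h] C by rewrite sub1seq.
    have a0A' : subseq [:: a0] A by rewrite sub1seq.
    have sub : subseq ([:: a0] ++ [:: h] ++ [:: x; y]) (A ++ n.+1 :: h :: B).
      apply: cat_subseq => //; rewrite EB.
      by apply: subseq_trans (subseq_cons _ _); apply: cat_subseq.
    have := avw _ _ _ _ sub; have := R_gt _ yR.
    by rewrite /forbidden; clear -lt_ha0 lt_yx; lia.
  (* The blocks are listed by increasing value, so that repeated use of [perm_iota_cat] shows each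
     to fill an interval. *)
  have pw2 : perm_eq (A0 ++ C ++ [:: a0] ++ (A1 ++ R) ++ [:: n.+1]) (iota 1
    n.+1).
    apply: perm_trans pw; apply/seq.permP => p.
    by rewrite EA EB !(count_cat, catA) /= count_cat; clear; lia.
  have A1A x : x \in A1 -> x \in A by rewrite EA mem_cat inE => ->;
    rewrite !orbT.
  have lt_n x : x \in A1 ++ R -> x < n.+1.
    by rewrite mem_cat => /orP[/A1A/ltA|/RB/ltB].
  have lt_a0 x : x \in (A1 ++ R) ++ [:: n.+1] -> a0 < x.
    by rewrite !mem_cat inE => /orP[/orP[/lt_a0A1|/R_gt]|/eqP->] //; apply: ltA.
  have [|pA0 pw3] := perm_iota_cat pw2.
    move=> x y xA0; have lt_xa0 : x < a0.
      by move: xA0; rewrite mem_filter /= => /andP[/ltn_trans->].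
    by rewrite 2!mem_cat mem_seq1 =>
      /or3P[/(A0_lt _ _ xA0)|/eqP->|/lt_a0/(ltn_trans lt_xa0)].
  have [|pC pw4] := perm_iota_cat pw3.
    move=> x y /C_lt lt_xa0.
    by rewrite mem_cat mem_seq1 => /orP[/eqP->|/lt_a0/(ltn_trans lt_xa0)].
  have [|pa0 pw5] := perm_iota_cat pw4.
    by move=> x y; rewrite inE => /eqP->; apply: lt_a0.
  have [|pAR _] := perm_iota_cat pw5.
    by move=> x y /lt_n ltx; rewrite mem_seq1 => /eqP->.
  have EA0 := sorted_perm_iota srtA0 pA0.
  have avC : avoid C by apply: avoid_subseq avB; apply: filter_subseq.
  have [u uW Cu] := words_interval pC avC.
  have szu : size u = size C := size_mem_words uW.
  set s := iota _ _ in pAR; constructor 3.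
  (* The bits tell, for each value strictly between [a0] and [n.+1], whether it goes to [A1] or to
     [R]. The bit of [d] is false, so they are not all true. *)
  exists (size A0), (map (mem A1) s), u.
  have Ea0 : a0 = (size A0 + size C).+1.
    by have /perm_mem/(_ a0) := pa0; rewrite !inE eqxx => /esym/eqP.
  have Es : s = iota (size A0 + size C).+2 (size (A1 ++ R)).
    by rewrite /s; congr iota; rewrite /=; clear; lia.
  have szs : size s = size (A1 ++ R) by rewrite size_iota.
  have srts : sorted ltn s by apply: iota_ltn_sorted.
  have EmA : mask (map (mem A1) s) s = A1.
    rewrite -filter_mask; apply: (irr_sorted_eq ltn_trans ltnn).
    - exact: sorted_filter ltn_trans _ _ srts.
    - by move: srtA1 => /= /path_sorted.
    - by move=> x; rewrite mem_filter -(perm_mem pAR) mem_cat /=;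
      case: (x \in A1).
  have EmR : mask (map negb (map (mem A1) s)) s = R.
    rewrite -map_comp -filter_mask; apply: (irr_sorted_eq ltn_trans ltnn) => //.
      exact: sorted_filter ltn_trans _ _ srts.
    move=> x; rewrite mem_filter -(perm_mem pAR) mem_cat /=.
    case: (boolP (x \in A1)) => //= xA1; apply/esym/negP => /RB.
    by move=> /(disj _ _ (A1A _ xA1)); rewrite eqxx.
  split.
  - rewrite size_map szs szu -szw EA EB !size_cat /=; clear; lia.
  - rewrite szu -has_predC; apply/andP; split; first by case: (C) hC.
    apply/hasP; exists (d \in A1); last first.
      by apply/negP => /A1A dA; have := disj _ _ dA dB; rewrite eqxx.
    by apply/mapP; exists d => //; rewrite -(perm_mem pAR) mem_cat dR orbT.
  - by rewrite szu.
  rewrite /sorted_word size_map szs szu -Es EmA EmR -Cu -EA0 -Ea0 -EA -EB.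
  congr (A ++ _ :: _); rewrite Ea0 -szw EA EB !size_cat /=; clear; lia.
(* Entries of A below [h] are below all of B by [F2h], and those above [h] are above all of B by
   [noA]. *)
have A_out a d : a \in A -> d \in h :: B -> (a < d) = (a < h).
  move=> aA dB; have := disj _ _ aA dB; have := F2h a d aA dB.
  have := disj _ _ aA (mem_head h B).
  have /hasPn/(_ a aA)/hasPn/(_ d dB) := noA.
  by clear; lia.
constructor 2; set L := filter (predC (ltn h)) A; set H := filter (ltn h) A.
have L_lt a : a \in L -> a < h.
  rewrite mem_filter /= -leqNgt => /andP[leah aA].
  by rewrite ltn_neqAle leah andbT disj ?mem_head.
have pw2 : perm_eq (L ++ ((h :: B) ++ (H ++ [:: n.+1]))) (iota 1 n.+1).
  apply: perm_trans pw; apply/seq.permP => p.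
  have /seq.permP/(_ p) : perm_eq (H ++ L) A by rewrite perm_filterC.
  by rewrite !count_cat /= => <-; clear; lia.
have lt_LB : {in L & (h :: B) ++ (H ++ [:: n.+1]), forall x y, x < y}.
  move=> x y xL; have lt_xh := L_lt x xL.
  have xA : x \in A by move: xL; rewrite mem_filter => /andP[].
  rewrite !mem_cat => /or3P[yB||].
  - by rewrite A_out.
  - by rewrite mem_filter => /andP[/= /(ltn_trans lt_xh)].
  - by rewrite inE => /eqP ->; apply: ltA.
have [pL pw3] := perm_iota_cat pw2 lt_LB.
have lt_BH : {in h :: B & H ++ [:: n.+1], forall x y, x < y}.
  move=> x y xB; rewrite mem_cat inE => /orP[|/eqP->]; last exact: ltB.
  rewrite mem_filter => /andP[/= lt_hy yA].
  have := A_out y x yA xB; have := disj y x yA xB; clear -lt_hy; lia.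
have [pB pw4] := perm_iota_cat pw3 lt_BH.
have lt_Hn : {in H & [:: n.+1], forall x y, x < y}.
  by move=> x y; rewrite mem_filter => /andP[_ /ltA ltx]; rewrite inE => /eqP->.
have [pH _] := perm_iota_cat pw4 lt_Hn.
have mono p x y : subseq [:: x; y] (filter p A) ->
    [/\ p x, p y, subseq [:: x; y] A & x != y].
  rewrite subseq_filter /= andbT => /andP[/andP[px py] xy]; split=> //.
  exact: subseq2_neq xy.
(* By [F1] an inversion of A straddles [h], so none lies within [L], nor within [H]. *)
have srtL : sorted ltn L.
  apply: sorted_subseq2 => x y /mono[/= lex ley xy neq].
  have := F1 x y h xy; rewrite mem_head; clear -neq lex ley; lia.
have srtH : sorted ltn H.
  apply: sorted_subseq2 => x y /mono[/= ltx lty xy neq].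
  have := F1 x y h xy; rewrite mem_head; clear -neq ltx lty; lia.
have EL := sorted_perm_iota srtL pL; have EH := sorted_perm_iota srtH pH.
have [u uW Bu] := words_interval pB avB.
have szu : size u = (size B).+1 := size_mem_words uW.
exists (map (ltn h) A), u; rewrite size_map szu; split=> //.
rewrite /shuffled_word count_map size_map szu.
have szL : count [preim ltn h of negb] A = size L by rewrite size_filter.
rewrite szL -Bu (szw : _ + (size B).+1 = n) -shuffleE //.
- by rewrite -/L -size_filter -/L.
- by rewrite -/H -size_filter -/H [LHS]EH; congr iota; rewrite /=; clear; lia.
Qed.

(** * Conversely, words of the three shapes are avoiders *)

(** None of the three patterns ends in its largest letter, so an occurrence cannot use the final
    [n.+1]. *)
Lemma rcons_words n u : u \in words n -> rcons u n.+1 \in words n.+1.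
Proof.
move=> /[dup] uW /mem_words[pu avu].
have pw : perm_eq (u ++ [:: n.+1]) (iota 1 n.+1).
  have -> : iota 1 n.+1 = iota 1 n ++ [:: n.+1] by have := iotaD 1 n 1;
    rewrite addn1 add1n.
  by rewrite perm_cat2r.
rewrite -cats1; apply/mem_words; split=> // a b c d sub.
have uw : uniq (u ++ [:: n.+1]) by rewrite (perm_uniq pw) iota_uniq.
have le_n x : x \in [:: a; b; c; d] -> x <= n.+1.
  by move/(mem_subseq sub); rewrite (perm_mem pw) mem_iota => /andP[].
have [[_ _ ad] [_ bd cd]] := subseq4 sub.
have le_a := le_n a; have le_b := le_n b; have le_c := le_n c.
rewrite !inE !eqxx ?orbT in le_a le_b le_c.
case: (boolP (d \in u)) => du; last first.
  have : d \in u ++ [:: n.+1] by apply: (mem_subseq sub);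
    rewrite !inE eqxx !orbT.
  rewrite mem_cat (negPf du) inE => /eqP ->; rewrite /forbidden.
  by move: (le_a isT) (le_b isT) (le_c isT); clear; lia.
apply: avu; apply: subseq_uniq_sub sub _ => //; first exact: prefix_subseq.
apply/allP; rewrite /= du (subseq2_catl uw ad du) (subseq2_catl uw bd du).
by rewrite (subseq2_catl uw cd du).
Qed.

Lemma mem_shuffle_bounds t l b x : l = count negb t ->
  x \in shuffle t 1 (l + b).+1 ->
  (0 < x <= size t + b) && ((x <= l) || (l + b < x)).
Proof.
move=> ->; rewrite (perm_mem (perm_shuffle _ _ _)) mem_cat !mem_iota.
have := count_predC negb t; rewrite (eq_count (_ : predC negb =1 id));
  last first.
  by move=> y /=; rewrite negbK.
lia.
Qed.

Lemma shuffled_word_words t u : 0 < size u -> u \in words (size u) ->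
  shuffled_word t u \in words (size t + size u).+1.
Proof.
move=> u_gt0 /[dup] uW /mem_words[pu avu].
set l := count negb t; set n := size t + size u.
have le_l : l <= size t by apply: count_size.
have pw : perm_eq (shuffled_word t u) (iota 1 n.+1).
  have ct : size t = l + count id t.
    by rewrite -(count_predC negb t) /l; congr (_ + _);
      apply: eq_count => y /=; rewrite negbK.
  have En : iota 1 n.+1 = iota 1 l ++ map (addn l) (iota 1 (size u)) ++
                          iota (l + size u).+1 (count id t) ++ [:: n.+1].
    rewrite -iotaDl -[[:: n.+1]]/(iota n.+1 1) /n ct.
    have -> : (l + count id t + size u).+1 =
      l + (size u + (count id t + 1)) by lia.
    by rewrite !iotaD; congr (_ ++ (iota _ _ ++ (iota _ _ ++ iota _ _))); lia.
  rewrite En /shuffled_word -/l -/n; apply/seq.permP => p.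
  have /seq.permP/(_ p) := perm_shuffle t 1 (l + size u).+1.
  have /seq.permP/(_ p) := perm_map (addn l) pu.
  rewrite !count_cat /= -/l => -> ->; lia.
apply/mem_words; split=> //.
rewrite /shuffled_word -/l -/n -[map _ u]cats0.
have bd x : x \in shuffle t 1 (l + size u).+1 -> _ := mem_shuffle_bounds erefl.
have lt1 : l < (l + size u).+1 by rewrite ltnS leq_addr.
(* The threshold is [l] for the low run and [l + size u] for the high run, the two ends of the range
   of values of B. *)
have [EL _] := filter_shuffle (leqnn (1 + l)) lt1.
have [_ EH] := filter_shuffle (lt1 : 1 + l <= _) (leqnn _).
apply: (@avoid_inflation _ _ _ _ l (l + size u)); rewrite ?leq_addr //.
- by rewrite cats0 (perm_uniq pw) iota_uniq.
- move=> x; rewrite cats0 mem_cat => /orP[/bd|/mapP[y /(bound_words uW)]];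
  rewrite /n.
    by lia.
  by move=> ? ->; lia.
- by move=> x /bd /andP[].
- by rewrite EL iota_ltn_sorted.
- by rewrite EH iota_ltn_sorted.
- by move=> x /mapP[y /(bound_words uW) ? ->]; lia.
- by left.
- by apply/avoid_addl.
Qed.

Lemma sorted_word_words i t u : 0 < size u -> u \in words (size u) ->
  sorted_word i t u \in words ((i + size u).+1 + size t).+1.
Proof.
move=> u_gt0 /[dup] uW /mem_words[pu avu].
set k := (i + size u).+1; set n := k + size t; set s := iota k.+1 (size t).
have szs : size t = size s by rewrite size_iota.
have pw : perm_eq (sorted_word i t u) (iota 1 n.+1).
  have En : iota 1 n.+1 = iota 1 i ++ map (addn i) (iota 1 (size u)) ++
                          [:: k] ++ s ++ [:: n.+1].
    rewrite -iotaDl -[[:: n.+1]]/(iota n.+1 1) -[[:: k]]/(iota k 1) /s /n.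
    have -> : (k + size t).+1 = i + (size u + (1 + (size t + 1))) by rewrite
      /k; lia.
    by rewrite !iotaD; congr (_ ++ (iota _ _ ++ (iota _ _ ++ (iota _ _ ++ iota
      _ _)))); lia.
  rewrite En /sorted_word -/k -/n -/s; apply/seq.permP => p.
  have /seq.permP/(_ p) := perm_mask szs.
  have /seq.permP/(_ p) := perm_map (addn i) pu.
  rewrite -(cat1s k) -(cat1s n.+1) !count_cat => -> <- /=; lia.
apply/mem_words; split=> //.
rewrite /sorted_word -/k -/n -/s.
have mems x : x \in s -> k < x <= n by rewrite mem_iota /n; lia.
have memA x : x \in iota 1 i ++ k :: mask t s -> (0 < x <= i) || (k <= x <= n).
  rewrite mem_cat inE mem_iota => /orP[|/orP[/eqP->|/mem_mask/mems]];
    rewrite /n; lia.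
(* This is the alternative of [avoid_inflation] in which the block after C may be nonempty. *)
have srtA : sorted ltn (iota 1 i ++ k :: mask t s).
  have -> : k :: mask t s = mask (true :: t) (k :: s) by [].
  have sub : subseq (iota 1 i ++ mask (true :: t) (k :: s)) (iota 1 i ++ k ::
    s).
    by apply: cat_subseq => //; apply: mask_subseq.
  apply: (subseq_sorted ltn_trans sub).
  rewrite (sorted_pairwise ltn_trans) pairwise_cat -!(sorted_pairwise
    ltn_trans).
  rewrite iota_ltn_sorted (iota_ltn_sorted k (size t).+1) !andbT.
  apply/allrelP => x y; rewrite (mem_iota k (size t).+1) mem_iota /k; lia.
apply: (@avoid_inflation _ _ _ _ i (i + size u)); rewrite ?leq_addr //.
- by rewrite (perm_uniq pw) iota_uniq.
- move=> x; rewrite mem_cat => /orP[/memA|]; first by rewrite /n /k; lia.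
  rewrite mem_cat => /orP[/mapP[y /(bound_words uW) ? ->]|/mem_mask/mems];
    rewrite /n /k; lia.
- by move=> x /memA; rewrite /k; lia.
- exact: sorted_filter ltn_trans _ _ srtA.
- exact: sorted_filter ltn_trans _ _ srtA.
- by move=> x /mapP[y /(bound_words uW) ? ->]; lia.
- by move=> x /mem_mask/mems; rewrite /k; lia.
- exact: (subseq_sorted ltn_trans (mask_subseq _ _) (iota_ltn_sorted _ _)).
- by right.
- by apply/avoid_addl.
Qed.

(** * Uniqueness of the decomposition *)

Lemma max_notin_prefix n A B : A ++ n.+1 :: B \in words n.+1 -> n.+1 \notin A.
Proof.
case/mem_words=> /perm_uniq; rewrite iota_uniq cat_uniq /= negb_or.
by case/and3P=> _ /andP[].
Qed.

Lemma head_words u : 0 < size u -> u \in words (size u) ->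
  0 < head 0 u <= size u.
Proof. by case: u => // h u _ /bound_words/(_ (mem_head _ _)). Qed.

Lemma head_map_cat (T T' : Type) (f : T -> T') x y s s' : 0 < size s ->
  head y (map f s ++ s') = f (head x s).
Proof. by case: s. Qed.

(** The largest entry determines A and B. The first entry of B lies in value between the two runs of
    A, so comparing A with it gives [t]; then the shift of [u] is known. *)
Lemma shuffled_word_inj t u t' u' : 0 < size u -> 0 < size u' ->
    u \in words (size u) -> u' \in words (size u') ->
    size t + size u = size t' + size u' ->
  shuffled_word t u = shuffled_word t' u' -> t = t' /\ u = u'.
Proof.
move=> u0 u0' uW uW' sz eqw.
have := max_notin_prefix (shuffled_word_words t' u0' uW').
have := max_notin_prefix (shuffled_word_words t u0 uW).
move: eqw; rewrite /shuffled_word -sz => eqw nA nA';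
  have [eqA eqB] := cat_cons_inj nA nA' eqw.
have bh := head_words u0 uW; have bh' := head_words u0' uW'.
have eqh : count negb t + head 0 u = count negb t' + head 0 u'.
  by have := congr1 (head 0) eqB;
    rewrite -[map _ u]cats0 -[map _ u']cats0 !(head_map_cat _ 0).
have eqt : t = t'.
  have map_t (v : seq nat) r k : 0 < k <= size v ->
      map (ltn (count negb r + k)) (shuffle r 1 (count negb r + size v).+1) = r.
    by move=> bk; apply: map_ltn_shuffle; clear -bk; lia.
  by rewrite -[LHS](map_t u _ _ bh) eqA eqh (map_t u').
by split=> //; move: eqB; rewrite -eqt => /(inj_map (@addnI _)).
Qed.

(** The number of entries of A below the first entry of B is [i]. The next entry of A is the
    separator, whose value gives [size u]; the rest of A gives [t]. *)
Lemma sorted_word_inj i t u i' t' u' : 0 < size u -> 0 < size u' ->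
    u \in words (size u) -> u' \in words (size u') ->
    (i + size u).+1 + size t = (i' + size u').+1 + size t' ->
  sorted_word i t u = sorted_word i' t' u' -> [/\ i = i', t = t' & u = u'].
Proof.
move=> u0 u0' uW uW' sz eqw.
have := max_notin_prefix (sorted_word_words i' t' u0' uW').
have := max_notin_prefix (sorted_word_words i t u0 uW).
move: eqw; rewrite /sorted_word -sz => eqw nA nA';
  have [eqA eqB] := cat_cons_inj nA nA' eqw.
have count_lt j (v : seq nat) r h : 0 < h <= size v ->
    count (gtn (j + h)) (iota 1 j ++ (j + size v).+1 ::
      mask r (iota (j + size v).+2 (size r))) = j.
  move=> bh; rewrite count_cat /=.
  rewrite (_ : count _ (iota 1 j) = j); last first.
    rewrite -[RHS](size_iota 1 j); apply/eqP; rewrite -all_count;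
      apply/allP => x.
    by rewrite mem_iota /=; clear -bh; lia.
  rewrite (_ : (_ < _) = false); last by clear -bh; lia.
  rewrite (_ : count _ (mask _ _) = 0) ?addn0 //.
  apply/eqP; rewrite -leqn0 leqNgt -has_count; apply/hasPn => x /mem_mask.
  by rewrite mem_iota /=; clear -bh; lia.
have bh := head_words u0 uW; have bh' := head_words u0' uW'.
have eqh : i + head 0 u = i' + head 0 u'.
  by have := congr1 (head 0) eqB; rewrite !(head_map_cat _ 0).
have eqi : i = i' by rewrite -[LHS](count_lt _ _ t _ bh) eqA eqh count_lt.
subst i'; have eqk : size u = size u'.
  have := congr1 (fun s => nth 0 s i) eqA.
  by rewrite !nth_cat size_iota ltnn subnn /=; clear; lia.
have eqt : size t = size t' by clear -eqk sz; lia.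
move: eqA eqB; rewrite eqk eqt => /eqP;
  rewrite eqseq_cat // => /andP[_ /eqP[eqm]] /eqP.
rewrite eqseq_cat ?size_map // => /andP[/eqP/(inj_map (@addnI _)) equ _];
  split=> //.
by apply: mask_inj eqm; rewrite ?iota_uniq ?size_iota.
Qed.

(** If [t'] has a false bit, B has entries on both sides of the separator [k], which is in A. In a
    shuffled word no entry of A lies within the range of B. *)
Lemma shuffled_word_neq_sorted_word t u i t' u' : 0 < size u -> 0 < size u' ->
    u \in words (size u) -> u' \in words (size u') -> ~~ all id t' ->
    size t + size u = (i + size u').+1 + size t' ->
  shuffled_word t u <> sorted_word i t' u'.
Proof.
move=> u0 u0' uW uW' nall sz eqw.
have := max_notin_prefix (sorted_word_words i t' u0' uW').
have := max_notin_prefix (shuffled_word_words t u0 uW).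
move: eqw; rewrite /shuffled_word /sorted_word sz.
set k := (i + size u').+1; set s := iota k.+1 _.
move=> eqw nA nA'; have [eqA eqB] := cat_cons_inj nA nA' eqw.
set l := count negb t in eqA eqB.
have Bl x : x \in map (addn l) u -> l < x <= l + size u.
  by case/mapP=> y /(bound_words uW) ? ->; lia.
have [h hB lt_hk] : exists2 h, h \in map (addn l) u & h < k.
  have /andP[_ le_h] := head_words u0' uW'.
  exists (i + head 0 u'); last by rewrite ltnS leq_add2l.
  by rewrite eqB mem_cat map_f //; case: (u') u0' => // h v; rewrite mem_head.
have [r rB lt_kr] : exists2 r, r \in map (addn l) u & k < r.
  have /hasP[r rR _] : has predT (mask (map negb t') s).
    rewrite has_predT size_mask ?size_map ?size_iota // count_map.
    by rewrite -has_count has_predC.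
  exists r; first by rewrite eqB mem_cat rR orbT.
  by move: (mem_mask rR); rewrite mem_iota => /andP[].
have kA : k \in shuffle t 1 (l + size u).+1 by rewrite eqA mem_cat mem_head
  orbT.
have := mem_shuffle_bounds erefl kA; have := Bl _ hB; have := Bl _ rB.
rewrite -/l; clear -lt_hk lt_kr; lia.
Qed.

(** * Enumeration of the codes and the recurrence for the counts *)

Definition bitseqs m : seq bitseq := map val (enum {: m.-tuple bool}).

Lemma mem_bitseqs m t : (t \in bitseqs m) = (size t == m).
Proof.
apply/mapP/idP => [[s _ ->]|sz]; first by rewrite size_tuple.
by exists (Tuple sz); rewrite ?mem_enum.
Qed.

Lemma uniq_bitseqs m : uniq (bitseqs m).
Proof. by rewrite (map_inj_uniq val_inj) enum_uniq. Qed.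

Lemma size_bitseqs m : size (bitseqs m) = 2 ^ m.
Proof. by rewrite size_map -cardE card_tuple card_bool. Qed.

(* The all-true mask is excluded: it would leave nothing after C, and the word
   would already be a [shuffled_word]. *)
Definition tail_codes m : seq (nat * bitseq) :=
  [seq (i, t) | i <- iota 0 m, t <- rem (nseq (m - i.+1) true) (bitseqs (m -
    i.+1))].

Lemma mem_tail_codes m i t :
  ((i, t) \in tail_codes m) = (i.+1 + size t == m) && ~~ all id t.
Proof.
have all_idE (s : bitseq) : all id s = (s == nseq (size s) true).
  rewrite (eq_all (_ : id =1 pred1 true)); last by case.
  by apply/all_pred1P/eqP.
apply/allpairsPdep/andP => [[j [s []]]|[/eqP sz nall]].
  rewrite mem_iota mem_rem_uniq ?uniq_bitseqs // inE mem_bitseqs => lt_j.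
  move=> /andP[neq /eqP sz] [-> ->]; rewrite all_idE sz neq; split=> //.
  by move: lt_j sz; clear; lia.
have mi : m - i.+1 = size t by rewrite -sz addKn.
exists i, t; rewrite mem_iota mi mem_rem_uniq ?uniq_bitseqs // inE mem_bitseqs.
by rewrite -all_idE nall eqxx -sz addSn ltnS leq_addr.
Qed.

Lemma uniq_tail_codes m : uniq (tail_codes m).
Proof.
apply: allpairs_uniq_dep => [|i _|[i t] [i' t'] _ _ /= [-> ->]] //.
  exact: iota_uniq.
by rewrite rem_uniq ?uniq_bitseqs.
Qed.

(** The sum of 2^j - 1 over j < m is 2^m - 1 - m; the additive form avoids truncated subtraction. *)
Lemma size_tail_codes m : size (tail_codes m) + m.+1 = 2 ^ m.
Proof.
have -> : size (tail_codes m) = sumn [seq (2 ^ (m - i.+1)).-1 | i <- iota 0 m].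
  rewrite size_allpairs_dep; congr sumn; apply: eq_map => i.
  by rewrite size_rem ?size_bitseqs // mem_bitseqs size_nseq.
elim: m => // m IH; rewrite /= -[1]addn0 iotaDl -map_comp.
rewrite (eq_map (_ : _ =1 fun i => (2 ^ (m - i.+1)).-1)) => [|i]; last first.
  by rewrite /= add1n subSS.
by have := expn_gt0 2 m; rewrite subSS subn0 expnS -IH; lia.
Qed.

Definition shuffled_codes n : seq (bitseq * seq nat) :=
  [seq q | b <- iota 1 n, q <- [seq (t, u) | t <- bitseqs (n - b), u <- words
    b]].

Definition sorted_codes n : seq (nat * bitseq * seq nat) :=
  [seq q | b <- iota 1 n, q <- [seq (p, u) | p <- tail_codes (n - b), u <-
    words b]].

Lemma mem_shuffled_codes n t u : ((t, u) \in shuffled_codes n) =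
  [&& size t + size u == n, 0 < size u & u \in words (size u)].
Proof.
apply/allpairsPdep/and3P => [[b [q [bn /allpairsP[[s v] /= [st vW ->]] [->
  ->]]]]|].
  move: bn st; rewrite mem_bitseqs mem_iota (size_mem_words vW) vW => bn /eqP->.
  by split=> //; lia.
case=> /eqP sz u0 uW; exists (size u), (t, u); split=> //.
  by rewrite mem_iota; lia.
by apply: allpairs_f => //; rewrite mem_bitseqs -sz addnK.
Qed.

Lemma mem_sorted_codes n i t u : ((i, t, u) \in sorted_codes n) =
  [&& (i + size u).+1 + size t == n, ~~ all id t, 0 < size u & u \in words
    (size u)].
Proof.
apply/allpairsPdep/and4P => [[b [q [bn /allpairsP[[[j s] v] /= [st vW ->]] [->
  -> ->]]]]|].
  move: bn st; rewrite mem_tail_codes mem_iota (size_mem_words vW) vW =>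
    bn /andP[/eqP st nall].
  by split=> //; lia.
case=> /eqP sz nall u0 uW; exists (size u), (i, t, u); split=> //.
  by rewrite mem_iota; lia.
by apply: allpairs_f => //; rewrite mem_tail_codes nall andbT; lia.
Qed.

(** The key tells which list an element comes from, so the lists are disjoint. For the codes the key
    is the length of [u]. *)
Lemma uniq_allpairs_key (S T : eqType) (key : T -> S) (s : seq S) (t : S ->
  seq T) :
    uniq s -> (forall b, uniq (t b)) -> (forall b q, q \in t b -> key q = b) ->
  uniq [seq q | b <- s, q <- t b].
Proof.
move=> us ut kt; apply: allpairs_uniq_dep => // -[b q] [b' q'].
move=> /allpairsPdep[c [p [_ pt E]]] /allpairsPdep[c' [p' [_ pt' E']]] /= eq_q.
(* Passing to ordinary pairs lets the equality of tagged pairs be split by components. *)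
pose pr (z : {x : S & T}) : S * T := (tag z, tagged z).
have [-> Eq] : (b, q) = (c, p) := congr1 pr E.
have [-> Eq'] : (b', q') = (c', p') := congr1 pr E'.
by rewrite -(kt _ _ pt) -(kt _ _ pt') -Eq -Eq' eq_q.
Qed.

Lemma uniq_shuffled_codes n : uniq (shuffled_codes n).
Proof.
apply: (uniq_allpairs_key (key := fun q => size q.2)) =>
  [|b|b _ /allpairsP[q [_ uW ->]]].
- exact: iota_uniq.
- by apply: allpairs_uniq; rewrite ?uniq_bitseqs ?uniq_words // => -[? ?] [? ?].
- exact: size_mem_words uW.
Qed.

Lemma uniq_sorted_codes n : uniq (sorted_codes n).
Proof.
apply: (uniq_allpairs_key (key := fun q => size q.2)) =>
  [|b|b _ /allpairsP[q [_ uW ->]]].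
- exact: iota_uniq.
- by apply: allpairs_uniq; rewrite ?uniq_tail_codes ?uniq_words // =>
  -[? ?] [? ?].
- exact: size_mem_words uW.
Qed.

Lemma size_words_rec n : size (words n.+1) =
  size (words n) +
  sumn [seq (2 ^ (n - b) + size (tail_codes (n - b))) * size (words b) | b <-
    iota 1 n].
Proof.
pose W := [seq rcons u n.+1 | u <- words n] ++
  [seq shuffled_word q.1 q.2 | q <- shuffled_codes n] ++ [seq sorted_word q.1.1
    q.1.2 q.2 | q <- sorted_codes n].
have -> : size (words n.+1) = size W.
  apply/perm_size/uniq_perm; first exact: uniq_words.
    rewrite !cat_uniq; apply/and5P; split.
    - by rewrite (map_inj_uniq (@rcons_injl _ n.+1)) uniq_words.
    (* The first shape is the one with nothing after [n.+1], hence it is disjoint from the other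
       two. *)
    - have last_neq A B u : 0 < size B -> u \in words n ->
        A ++ n.+1 :: B \in words n.+1 -> A ++ n.+1 :: B != rcons u n.+1.
        move=> B0 uW AW; apply/eqP; rewrite -cats1 => eqw.
        have := rcons_words uW; rewrite -cats1 => /max_notin_prefix nu.
        have [_ B_nil] := cat_cons_inj (max_notin_prefix AW) nu eqw.
        by rewrite B_nil in B0.
      apply/hasPn => w; rewrite mem_cat => /orP[]/mapP[].
        move=> [t u]; rewrite mem_shuffled_codes => /and3P[/eqP sz u0 uW] ->.
        apply/mapP=> -[v vW]; apply/eqP; have := shuffled_word_words t u0 uW.
        by rewrite /shuffled_word sz => /last_neq; apply; rewrite ?size_map.
      move=> [[i t] u]; rewrite mem_sorted_codes => /and4P[/eqP sz _ u0 uW] ->.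
      apply/mapP=> -[v vW]; apply/eqP; have := sorted_word_words i t u0 uW.
      rewrite /sorted_word sz => /last_neq; apply=> //.
      by rewrite size_cat size_map addn_gt0 u0.
    - rewrite map_inj_in_uniq ?uniq_shuffled_codes // => -[t u] [t' u'].
      rewrite !mem_shuffled_codes =>
        /and3P[/eqP sz u0 uW] /and3P[/eqP sz' u0' uW'] /= eqw.
      by have [|-> ->] := shuffled_word_inj u0 u0' uW uW' _ eqw;
        rewrite ?sz ?sz'.
    - apply/hasPn => _ /mapP[[[i t] u] /= cu ->];
      apply/mapP=> -[[t' u'] cu' /esym].
      move: cu cu'; rewrite mem_shuffled_codes mem_sorted_codes.
      move=> /and4P[/eqP sz nall u0 uW] /and3P[/eqP sz' u0' uW'].
      by apply: shuffled_word_neq_sorted_word; rewrite ?sz ?sz'.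
    - rewrite map_inj_in_uniq ?uniq_sorted_codes // => -[[i t] u] [[i' t'] u'].
      rewrite !mem_sorted_codes => /and4P[/eqP sz _ u0 uW] /and4P[/eqP sz' _
        u0' uW'] /= eqw.
      by have [|-> -> ->] := sorted_word_inj u0 u0' uW uW' _ eqw;
        rewrite ?sz ?sz'.
  move=> w; rewrite !mem_cat; apply/idP/or3P => [|[]/mapP[]].
  - case/mem_words => /words_decomp/[apply] -[[u uW ->]|[t [u [sz u0 uW
    ->]]]|[i [t [u [sz]]]]].
    + by constructor 1; apply: map_f.
    + constructor 2; apply/mapP; exists (t, u) => //.
      by rewrite mem_shuffled_codes sz eqxx u0.
    + case/andP=> u0 nall uW ->; constructor 3; apply/mapP;
      exists (i, t, u) => //.
      by rewrite mem_sorted_codes sz eqxx u0 nall.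
  - by move=> u uW ->; apply: rcons_words.
  - move=> [t u]; rewrite mem_shuffled_codes => /and3P[/eqP <- u0 uW] ->.
    exact: shuffled_word_words.
  - move=> [[i t] u]; rewrite mem_sorted_codes => /and4P[/eqP <- _ u0 uW] ->.
    exact: sorted_word_words.
rewrite !size_cat !size_map !size_allpairs_dep; congr (_ + _).
rewrite !sumnE !big_map -big_split /=; apply: eq_bigr => b _.
by rewrite !size_allpairs mulnDl size_bitseqs.
Qed.

(** * Division of formal power series *)

Local Open Scope ring_scope.

Section FpsDivision.

Variable K : fieldType.
Implicit Types f g h : fps K.

Definition truncate f N : {poly K} := \poly_(i < N.+1) f i.

(** Low coefficients of a product depend only on truncations, so associativity and commutativity are
    inherited from polynomials. *)
Lemma fps_mul_coef f g n N : (n <= N)%N ->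
  fps_mul f g n = (truncate f N * truncate g N)`_n.
Proof.
move=> le_nN; rewrite coefM; apply: eq_bigr => i _.
by rewrite !coef_poly !ifT // ltnS; have := ltn_ord i; lia.
Qed.

Lemma fps_mulA f g h : fps_mul f (fps_mul g h) =1 fps_mul (fps_mul f g) h.
Proof.
move=> n; transitivity ((truncate f n * (truncate g n * truncate h n))`_n).
  rewrite coefM; apply: eq_bigr => i _; rewrite coef_poly ltn_ord.
  by rewrite (@fps_mul_coef _ _ _ n) ?leq_subr.
rewrite mulrA coefM; apply: eq_bigr => i _; rewrite -fps_mul_coef 1?leq_ord //.
by rewrite coef_poly ltnS leq_subr.
Qed.

Lemma fps_mulC f g : fps_mul f g =1 fps_mul g f.
Proof. by move=> n; rewrite !(fps_mul_coef _ _ (leqnn n)) mulrC. Qed.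

Lemma fps_mulf1 f : fps_mul f (fps_of_poly 1) =1 f.
Proof.
move=> n; rewrite /fps_mul big_ord_recr /= subnn /fps_of_poly coef1 mulr1.
rewrite big1 ?add0r // => i _.
by rewrite coef1 subn_eq0 leqNgt ltn_ord mulr0.
Qed.

Lemma eq_fps_mul f f' g g' : f =1 f' -> g =1 g' -> fps_mul f g =1 fps_mul f' g'.
Proof. by move=> ef eg n; apply: eq_bigr => i _; rewrite ef eg. Qed.

Lemma fps_divP f g h : h 0%N != 0 -> fps_mul f h =1 g -> f =1 fps_div g h.
Proof.
move=> h0 fh n; rewrite /fps_div -(eq_fps_mul fh (frefl _)) -fps_mulA.
rewrite (eq_fps_mul (frefl f) (g' := fps_of_poly 1)) ?fps_mulf1 // => m.
by rewrite fps_mulC fps_mulVf.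
Qed.

End FpsDivision.

Lemma fps_mul_poly5 (f : fps rat) (q0 q1 q2 q3 q4 : rat) (Q : {poly rat}) :
  (forall i, Q`_i = nth 0 [:: q0; q1; q2; q3; q4] i) ->
  [/\ fps_mul f (fps_of_poly Q) 0%N = f 0%N * q0,
      fps_mul f (fps_of_poly Q) 1%N = f 0%N * q1 + f 1%N * q0,
      fps_mul f (fps_of_poly Q) 2%N = f 0%N * q2 + f 1%N * q1 + f 2%N * q0,
      fps_mul f (fps_of_poly Q) 3%N =
        f 0%N * q3 + f 1%N * q2 + f 2%N * q1 + f 3%N * q0 &
      forall n, fps_mul f (fps_of_poly Q) n.+4 =
        f n * q4 + f n.+1 * q3 + f n.+2 * q2 + f n.+3 * q1 + f n.+4 * q0].
Proof.
move=> QE; rewrite /fps_mul /fps_of_poly.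
split; try by rewrite !big_ord_recr big_ord0 /= !QE add0r.
(* The terms with [i < n] involve coefficients of [Q] of index above 4, which vanish. *)
move=> n; rewrite !big_ord_recr /= !QE big1 => [|i _]; last first.
  by rewrite QE nth_default ?mulr0 //= ; have := ltn_ord i; lia.
have -> : (n.+4 - n = 4)%N by lia.
have -> : (n.+4 - n.+1 = 3)%N by lia.
have -> : (n.+4 - n.+2 = 2)%N by lia.
have -> : (n.+4 - n.+3 = 1)%N by lia.
by rewrite subnn /= add0r.
Qed.

(** * The linear recurrence and the generating function *)

Definition nwords n : rat := (size (words n))%:R.

(* [nwords], [geom_sum], [plain_sum] and [linear_sum] evolve together under a
   4x4 matrix, whose characteristic polynomial is the reversed denominator. *)
Definition geom_sum n : rat := \sum_(1 <= b < n.+1) 2 ^+ (n - b) * nwords b.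
Definition plain_sum n : rat := \sum_(1 <= b < n.+1) nwords b.
Definition linear_sum n : rat := \sum_(1 <= b < n.+1) (n - b).+1%:R * nwords b.

Lemma geom_sumS n : geom_sum n.+1 = 2 * geom_sum n + nwords n.+1.
Proof.
rewrite /geom_sum big_nat_recr //= subnn mul1r; congr (_ + _).
rewrite big_distrr /= !big_nat; apply: eq_bigr => b /andP[_ ltb].
by rewrite mulrA -exprS subSn.
Qed.

Lemma plain_sumS n : plain_sum n.+1 = plain_sum n + nwords n.+1.
Proof. by rewrite /plain_sum big_nat_recr. Qed.

(** Each old weight grows by one and the new term has weight one. *)
Lemma linear_sumS n : linear_sum n.+1 = linear_sum n + plain_sum n.+1.
Proof.
rewrite plain_sumS /linear_sum /plain_sum big_nat_recr //= subnn mul1r addrA;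
  congr (_ + _).
rewrite -big_split /= !big_nat; apply: eq_bigr => b /andP[_ ltb].
by rewrite subSn // -[in LHS]natr1 mulrDl mul1r.
Qed.

(** With m = n - b, the weight 2^m + (2^m - 1 - m) of [size_words_rec] is 2 * 2^m - (m + 1). *)
Lemma nwordsS n : nwords n.+1 = nwords n + 2 * geom_sum n - linear_sum n.
Proof.
rewrite /nwords size_words_rec natrD -addrA; congr (_ + _).
rewrite sumnE big_map natr_sum /geom_sum /linear_sum big_distrr -sumrB /=.
have -> : iota 1 n = index_iota 1 n.+1 by rewrite /index_iota subn1.
rewrite !big_nat; apply: eq_bigr => b _; rewrite natrM mulrA -mulrBl;
  congr (_ * _).
apply/eqP; rewrite eq_sym subr_eq -natrD -addnA size_tail_codes addnn -mul2n
  natrM natrX.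
by [].
Qed.

Lemma nwords0 : nwords 0 = 1.
Proof.
rewrite /nwords size_words (_ : avoiders 0 patterns = setT) ?cardsT ?card_Sn //.
apply/setP=> s; rewrite [RHS]inE; apply/avoidP => x y z t /size_subseq.
by rewrite size_one_line.
Qed.

Theorem theorem25 :
  avoidance_gf [:: [:: 2; 1; 4; 3]%N; [:: 2; 4; 3; 1]%N; [:: 3; 2; 4; 1]%N]
  =1 fps_div
       (fps_of_poly (1 - 5 * 'X + 7 * 'X^2 - 4 * 'X^3 : {poly rat}))
       (fps_of_poly (1 - 6 * 'X + 11 * 'X^2 - 9 * 'X^3 + 2 * 'X^4 : {poly rat})).
Proof.
have numC (k : nat) : (k%:R : {poly rat}) = (k%:R)%:P by rewrite polyC_natr.
set P := (1 - _ + _ - _); set Q := (_ + 2 * _).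
have PE i : P`_i = nth 0 [:: 1; -5; 7; -4] i.
  rewrite /P (numC 5) (numC 7) (numC 4) !(coefD, coefN, coefCM, coef1, coefX,
    coefXn).
  by case: i => [|[|[|[|[|i]]]]]; rewrite /= ?nth_nil; ring.
have QE i : Q`_i = nth 0 [:: 1; -6; 11; -9; 2] i.
  rewrite /Q (numC 6) (numC 11) (numC 9) (numC 2) !(coefD, coefN, coefCM,
    coef1, coefX, coefXn).
  by case: i => [|[|[|[|[|i]]]]]; rewrite /= ?nth_nil; ring.
apply: fps_divP; first by rewrite /fps_of_poly QE.
have gfE : avoidance_gf [:: [:: 2; 1; 4; 3]%N; [:: 2; 4; 3; 1]%N; [:: 3; 2; 4;
  1]%N] =1 nwords.
  by move=> n; rewrite /nwords size_words.
move=> n; rewrite (eq_fps_mul gfE (frefl _)) {gfE}.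
have sum0 : [/\ geom_sum 0 = 0, plain_sum 0 = 0 & linear_sum 0 = 0].
  by rewrite /geom_sum /plain_sum /linear_sum !big_geq.
have [s20 s10 sn0] := sum0; have [r0 r1 r2 r3 r4] := fps_mul_poly5 nwords QE.
(* The first four coefficients reduce to the initial values. From index 4 on the numerator
   contributes 0, and unfolding down to the four quantities at [n] leaves a polynomial identity. *)
case: n => [|[|[|[|n]]]]; rewrite ?(r0, r1, r2, r3, r4) /fps_of_poly PE /=
  ?nth_nil;
  rewrite ?(nwordsS, geom_sumS, linear_sumS, plain_sumS) ?s20 ?s10 ?sn0
    ?nwords0; ring.
Qed.
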